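(* Fix a vector $v\in\mathbb{H}_{\mathbb R}$ (i.e. a quaternion with zero scalar part). For $a>0$ put $q=a+v$. Then the quaternionic B-splines $B_q$ converge pointwise in the Fourier domain to a shifted and modulated Gaussian as $a\to\infty$ in the sense that, for every $\xi\in\mathbb{R}$, $$\lim_{a\to\infty}\frac{\widehat{B_q}(\xi/\sqrt a)}{e^{-i\sqrt a\,\xi/2}\,e^{-|v|/a}\,e^{-(\xi/\sqrt{24}+iv/\sqrt a)^2}\,e^{-\xi^2v/24a}}=1 .$$
   Context: $\mathbb{H}_{\mathbb R}$ is the real quaternion algebra with basis $1,e_1,e_2,e_3$, and $\mathbb{H}_{\mathbb C}$ its complexification (the complex unit $i$ commutes with $e_1,e_2,e_3$). For $z\in\mathbb{C}$ and $q=a+v$ with scalar part $a$ and vector part $v$, $z^q:=z^a[\cos(|v|\log z)+\frac{v}{|v|}\sin(|v|\log z)]\in\mathbb{H}_{\mathbb C}$ (principal branch $-\pi<\arg z\le\pi$; second term $0$ if $v=0$; $0^q:=0$ if $a>0$). $\widehat{B_q}(\xi)=\left(\frac{1-e^{-i\xi}}{i\xi}\right)^q$, the base being $1$ at $\xi=0$. For $p\in\mathbb{H}_{\mathbb C}$, $e^p=\sum_{j\ge0}p^j/j!$. Here $\xi^2v/24a$ means $\xi^2v/(24a)$. All quantities in the quotient lie in the commutative subalgebra of $\mathbb{H}_{\mathbb C}$ generated over $\mathbb{C}$ by $v$, and the denominator is invertible there. *)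

(* Defs.v *)
From HB Require Import structures.
From mathcomp Require Import all_boot all_order all_algebra.
From mathcomp Require Import complex ring.
From mathcomp Require Import all_classical all_reals all_analysis.

Set Implicit Arguments.
Unset Strict Implicit.
Unset Printing Implicit Defensive.

Import Order.TTheory GRing.Theory Num.Theory.
Import numFieldNormedType.Exports.
Local Open Scope ring_scope.
Local Open Scope complex_scope.
Local Open Scope classical_set_scope.

(* The quaternion algebra over [K], in coordinates with respect to the basis
   1, e1, e2, e3.  H_R is [quat R] and its complexification H_C is
   [quat R[i]].  It carries the topology (and sup norm) of [K^4]. *)
Definition quat (K : Type) := 'rV[K]_4.

HB.instance Definition _ (K : choiceType) := Choice.on (quat K).

Section QuatRing.
Variable K : fieldType.
Implicit Types p q r : quat K.

HB.instance Definition _ := GRing.Lmodule.on (quat K).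

Definition qscal q : K := q 0 (inord 0).
Definition q1 q : K := q 0 (inord 1).
Definition q2 q : K := q 0 (inord 2).
Definition q3 q : K := q 0 (inord 3).

Definition mkquat (a b c d : K) : quat K :=
  \row_(k < 4) [:: a; b; c; d]`_k.

Definition qone := mkquat 1 0 0 0.

Definition qmul p q := mkquat
  (qscal p * qscal q - q1 p * q1 q - q2 p * q2 q - q3 p * q3 q)
  (qscal p * q1 q + q1 p * qscal q + q2 p * q3 q - q3 p * q2 q)
  (qscal p * q2 q - q1 p * q3 q + q2 p * qscal q + q3 p * q1 q)
  (qscal p * q3 q + q1 p * q2 q - q2 p * q1 q + q3 p * qscal q).

Lemma qscalE a b c d : qscal (mkquat a b c d) = a.
Proof. by rewrite /qscal mxE inordK. Qed.
Lemma q1E a b c d : q1 (mkquat a b c d) = b.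
Proof. by rewrite /q1 mxE inordK. Qed.
Lemma q2E a b c d : q2 (mkquat a b c d) = c.
Proof. by rewrite /q2 mxE inordK. Qed.
Lemma q3E a b c d : q3 (mkquat a b c d) = d.
Proof. by rewrite /q3 mxE inordK. Qed.

Lemma quatP p q :
  qscal p = qscal q -> q1 p = q1 q -> q2 p = q2 q -> q3 p = q3 q -> p = q.
Proof.
rewrite /qscal /q1 /q2 /q3 => e0 e1 e2 e3; apply/rowP => k.
rewrite -(inord_val k).
by case: k => [[|[|[|[|k]]]]] //=.
Qed.

Lemma qscalD p q : qscal (p + q) = qscal p + qscal q. Proof. by rewrite /qscal mxE. Qed.
Lemma q1D p q : q1 (p + q) = q1 p + q1 q. Proof. by rewrite /q1 mxE. Qed.
Lemma q2D p q : q2 (p + q) = q2 p + q2 q. Proof. by rewrite /q2 mxE. Qed.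
Lemma q3D p q : q3 (p + q) = q3 p + q3 q. Proof. by rewrite /q3 mxE. Qed.
Lemma qscalZ c p : qscal (c *: p) = c * qscal p. Proof. by rewrite /qscal mxE. Qed.
Lemma q1Z c p : q1 (c *: p) = c * q1 p. Proof. by rewrite /q1 mxE. Qed.
Lemma q2Z c p : q2 (c *: p) = c * q2 p. Proof. by rewrite /q2 mxE. Qed.
Lemma q3Z c p : q3 (c *: p) = c * q3 p. Proof. by rewrite /q3 mxE. Qed.

Definition qcoordE := (qscalE, q1E, q2E, q3E, qscalD, q1D, q2D, q3D,
  (qscalZ, q1Z, q2Z, q3Z)).

Fact qmulA : associative qmul.
Proof. by move=> p q r; apply: quatP; rewrite /qmul !qcoordE; ring. Qed.
Fact qmul1l : left_id qone qmul.
Proof. by move=> p; apply: quatP; rewrite /qmul !qcoordE; ring. Qed.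
Fact qmul1r : right_id qone qmul.
Proof. by move=> p; apply: quatP; rewrite /qmul !qcoordE; ring. Qed.
Fact qmulDl : left_distributive qmul +%R.
Proof. by move=> p q r; apply: quatP; rewrite /qmul !qcoordE; ring. Qed.
Fact qmulDr : right_distributive qmul +%R.
Proof. by move=> p q r; apply: quatP; rewrite /qmul !qcoordE; ring. Qed.
Fact qone_neq0 : qone != 0.
Proof.
by apply/eqP => /(congr1 qscal); rewrite qscalE /qscal mxE => /eqP; rewrite oner_eq0.
Qed.

HB.instance Definition _ := GRing.Zmodule_isNzRing.Build (quat K)
  qmulA qmul1l qmul1r qmulDl qmulDr qone_neq0.

Fact qscaleAl (c : K) p q : c *: (p * q) = (c *: p) * q.
Proof. by apply: quatP; rewrite /GRing.mul /= /qmul !qcoordE; ring. Qed.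
HB.instance Definition _ := GRing.Lmodule_isLalgebra.Build K (quat K) qscaleAl.
Fact qscaleAr (c : K) p q : c *: (p * q) = p * (c *: q).
Proof. by apply: quatP; rewrite /GRing.mul /= /qmul !qcoordE; ring. Qed.
HB.instance Definition _ := GRing.Lalgebra_isAlgebra.Build K (quat K) qscaleAr.

Definition qconj q := mkquat (qscal q) (- q1 q) (- q2 q) (- q3 q).

(* [q * qconj q = (qnormsq q)%:A]; over [R[i]] this may vanish for [q != 0],
   and [q] is invertible exactly when it does not. *)
Definition qnormsq q : K := qscal q ^+ 2 + q1 q ^+ 2 + q2 q ^+ 2 + q3 q ^+ 2.

Definition qunit : {pred quat K} := fun q => qnormsq q != 0.
Definition qinv q : quat K :=
  if q \in qunit then (qnormsq q)^-1 *: qconj q else q.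

Lemma qone_def : (1 : quat K) = qone. Proof. by []. Qed.
Lemma qmul_def p q : p * q = qmul p q. Proof. by []. Qed.

Lemma qmul_conj q : q * qconj q = (qnormsq q)%:A.
Proof.
by apply: quatP;
  rewrite qone_def qmul_def /qmul /qconj /qnormsq !qcoordE; ring.
Qed.
Lemma qconj_mul q : qconj q * q = (qnormsq q)%:A.
Proof.
by apply: quatP;
  rewrite qone_def qmul_def /qmul /qconj /qnormsq !qcoordE; ring.
Qed.
Lemma qnormsqM p q : qnormsq (p * q) = qnormsq p * qnormsq q.
Proof. by rewrite qmul_def /qnormsq /qmul !qcoordE; ring. Qed.
Lemma qnormsq1 : qnormsq 1 = 1.
Proof. by rewrite qone_def /qnormsq !qcoordE; ring. Qed.

Fact qmulVr : {in qunit, left_inverse 1 qinv *%R}.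
Proof.
move=> q uq; rewrite /qinv uq -scalerAl qconj_mul scalerA mulVf ?scale1r //.
Qed.
Fact qmulrV : {in qunit, right_inverse 1 qinv *%R}.
Proof.
move=> q uq; rewrite /qinv uq -scalerAr qmul_conj scalerA mulVf ?scale1r //.
Qed.
Fact qunitP p q : q * p = 1 /\ p * q = 1 -> p \in qunit.
Proof.
case=> _ /(congr1 qnormsq); rewrite qnormsqM qnormsq1 => e.
apply/negP => /eqP z; move/eqP: e.
by rewrite z mul0r eq_sym oner_eq0.
Qed.
Fact qinv_out : {in [predC qunit], qinv =1 id}.
Proof. by move=> q; rewrite inE /qinv => /negbTE ->. Qed.

HB.instance Definition _ := GRing.NzRing_hasMulInverse.Build (quat K)
  qmulVr qmulrV qunitP qinv_out.

End QuatRing.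

HB.instance Definition _ (K : numFieldType) :=
  NormedModule.copy (quat K) 'rV[K]_4.

Section Functions.
Variable R : realType.
Implicit Types (z : R[i]) (q : quat R) (p : quat R[i]).

Definition cexp z : R[i] :=
  (expR (complex.Re z))%:C * (cos (complex.Im z) +i* sin (complex.Im z)).

Definition ccos z : R[i] := (cexp ('i%C * z) + cexp (- ('i%C * z))) / 2.
Definition csin z : R[i] :=
  (cexp ('i%C * z) - cexp (- ('i%C * z))) / (2 * 'i%C).

Definition cabs z : R := Num.sqrt (complex.Re z ^+ 2 + complex.Im z ^+ 2).

(* The principal argument, in ]-pi, pi]; a junk value at [z = 0]. *)
Definition carg z : R :=
  let t := acos (complex.Re z / cabs z) in
  if 0 <= complex.Im z then t else - t.

(* The principal logarithm; a junk value at [z = 0]. *)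
Definition clog z : R[i] := ln (cabs z) +i* carg z.

Definition qvec q : quat R := mkquat 0 (q1 q) (q2 q) (q3 q).
Definition qabs q : R := Num.sqrt (qnormsq q).

Definition quatC q : quat R[i] := map_mx (real_complex R) q.

(* [z ^ q].  The power [0 ^ q] is meant only for [qscal q > 0], where it
   is 0. *)
Definition cqpow z q : quat R[i] :=
  if z == 0 then 0 else
  let a := qscal q in
  let v := qvec q in
  let t := (qabs v)%:C * clog z in
  cexp (a%:C * clog z) *:
    ((ccos t)%:A +
     (if v == 0 then 0 else (csin t / (qabs v)%:C) *: quatC v)).

Definition Bhat q (xi : R) : quat R[i] :=
  cqpow (if xi == 0 then 1
         else (1 - cexp (- ('i%C * xi%:C))) / ('i%C * xi%:C)) q.

Definition qexp p : quat R[i] :=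
  limn (series (fun j : nat => (j`!%:R : R[i])^-1 *: p ^+ j)).

End Functions.

(* Main.v *)
(* Let [n = |v|] and let [u] be the unit with [v = i n u] and [u ^ 2 = 1].  The
   elements [(1 +- u) / 2] are complementary idempotents, so the subalgebra
   generated by [v] is a quotient of [C x C], where products, inverses,
   exponentials and the powers [z ^ q] are computed coordinatewise.  With
   [h = xi / (2 sqrt a)], the base of the power is [exp (- i h) (sin h / h)],
   and the quotient has the coordinates [exp (L n)] and [exp (L (- n))], where
     L s = a ln (sin h / h) + s h + n / a + (xi / sqrt 24 - s / sqrt a) ^ 2
           + i s (ln (sin h / h) + xi ^ 2 / (24 a)).
   As [sin h / h = 1 - h ^ 2 / 6 + O(h ^ 4)], the first term tends to
   [- xi ^ 2 / 24], hence [L s] to 0. *)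

Require Import Defs.
From mathcomp Require Import all_boot all_order all_algebra.
From mathcomp Require Import complex ring lra.
From mathcomp Require Import all_classical all_reals all_analysis.

Set Implicit Arguments.
Unset Strict Implicit.
Unset Printing Implicit Defensive.

Import Order.TTheory GRing.Theory Num.Theory.
Import numFieldNormedType.Exports.
Local Open Scope ring_scope.
Local Open Scope complex_scope.
Local Open Scope classical_set_scope.

(** * The complex exponential: functional equation, continuity, power series *)

Section ComplexExponential.
Variable R : realType.
Implicit Types (z w : R[i]) (x y t : R).

Lemma Re_add z w : complex.Re (z + w) = complex.Re z + complex.Re w.
Proof. by case: z w => [? ?] [? ?]. Qed.
Lemma Im_add z w : complex.Im (z + w) = complex.Im z + complex.Im w.
Proof. by case: z w => [? ?] [? ?]. Qed.
Lemma Re_mul z w : complex.Re (z * w) =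
  complex.Re z * complex.Re w - complex.Im z * complex.Im w.
Proof. by case: z w => [? ?] [? ?]. Qed.
Lemma Im_mul z w : complex.Im (z * w) =
  complex.Re z * complex.Im w + complex.Im z * complex.Re w.
Proof. by case: z w => [? ?] [? ?]. Qed.

Lemma normr_Re_le z : `|complex.Re z| <= Normc.normc z.
Proof.
case: z => x y /=; rewrite -sqrtr_sqr ler_wsqrtr // lerDl sqr_ge0 //.
Qed.
Lemma normr_Im_le z : `|complex.Im z| <= Normc.normc z.
Proof.
case: z => x y /=; rewrite -sqrtr_sqr ler_wsqrtr // lerDr sqr_ge0 //.
Qed.

Lemma cvg_complex {T : Type} {F : set_system T} {FF : Filter F}
  (f : T -> R[i]^o) (l : R[i]^o) :
  complex.Re (f t) @[t --> F] --> complex.Re l ->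
  complex.Im (f t) @[t --> F] --> complex.Im l -> f @ F --> l.
Proof.
move=> fr fi; apply/cvgrPdist_lt => /= e e0.
(* In the order of [R[i]] a positive number is real, so the radius [e] is a real one. Errors below
   [e / 2] in both components give a modulus below [e]. *)
have [e1 ei] : 0 < complex.Re e /\ complex.Im e = 0.
  by move: e0; rewrite ltcE /= => /andP[/eqP -> ->].
have ee : e = (complex.Re e)%:C by case: (e) ei => a b /= ->.
near=> t.
rewrite normc_def ee ltcR.
have h1 : `|complex.Re l - complex.Re (f t)| < complex.Re e / 2.
  by near: t; move/cvgrPdist_lt: fr; apply; rewrite divr_gt0.
have h2 : `|complex.Im l - complex.Im (f t)| < complex.Re e / 2.
  by near: t; move/cvgrPdist_lt: fi; apply; rewrite divr_gt0.
have -> : complex.Re (l - f t) = complex.Re l - complex.Re (f t).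
  by case: (l) (f t) => [? ?] [? ?].
have -> : complex.Im (l - f t) = complex.Im l - complex.Im (f t).
  by case: (l) (f t) => [? ?] [? ?].
rewrite -(gtr0_norm e1) -sqrtr_sqr ltr_sqrt ?exprn_gt0 //.
move: h1 h2; rewrite !ltr_norml => /andP[? ?] /andP[? ?]; nra.
Unshelve. all: by end_near. Qed.

Lemma cexpD z w : cexp (z + w) = cexp z * cexp w.
Proof.
case: z w => [a b] [c d]; rewrite /cexp /= expRD cosD sinD.
by simpc; apply/eqP; rewrite eq_complex /=; apply/andP; split; apply/eqP; ring.
Qed.

Lemma cexp0 : cexp (0 : R[i]) = 1.
Proof. by rewrite /cexp /= expR0 cos0 sin0; simpc. Qed.

Lemma cexpN z : cexp z * cexp (- z) = 1.
Proof. by rewrite -cexpD subrr cexp0. Qed.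

Lemma cexp_neq0 (z : R[i]) : cexp z != 0.
Proof. by apply: contra_eq_neq (cexpN z) => ->; rewrite mul0r eq_sym oner_eq0. Qed.

Lemma cexpV (z : R[i]) : (cexp z)^-1 = cexp (- z).
Proof. by apply: (mulfI (cexp_neq0 z)); rewrite cexpN mulfV // cexp_neq0. Qed.

Lemma normc_cexp z : Normc.normc (cexp z) = expR (complex.Re z).
Proof.
rewrite /cexp Normc.normcM /= cos2Dsin2 sqrtr1 mulr1.
by rewrite expr0n addr0 sqrtr_sqr ger0_norm ?expR_ge0.
Qed.

Lemma cvg_Re {T : Type} {F : set_system T} {FF : Filter F}
  (f : T -> R[i]^o) (l : R[i]^o) :
  f @ F --> l -> complex.Re (f t) @[t --> F] --> complex.Re l.
Proof.
move=> fl; apply/cvgrPdist_lt => e e0.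
have e0' : 0 < e%:C by rewrite ltcE /= eqxx.
near=> t.
have : `|l - f t| < e%:C by near: t; move/cvgrPdist_lt: fl; exact.
rewrite normc_def ltcR; apply: le_lt_trans.
by have := normr_Re_le (l - f t); case: (l) (f t) => [a b] [c d].
Unshelve. all: by end_near. Qed.

Lemma cvg_Im {T : Type} {F : set_system T} {FF : Filter F}
  (f : T -> R[i]^o) (l : R[i]^o) :
  f @ F --> l -> complex.Im (f t) @[t --> F] --> complex.Im l.
Proof.
move=> fl; apply/cvgrPdist_lt => e e0.
have e0' : 0 < e%:C by rewrite ltcE /= eqxx.
near=> t.
have : `|l - f t| < e%:C by near: t; move/cvgrPdist_lt: fl; exact.
rewrite normc_def ltcR; apply: le_lt_trans.
by have := normr_Im_le (l - f t); case: (l) (f t) => [a b] [c d].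
Unshelve. all: by end_near. Qed.

Lemma continuous_cexp : continuous (@cexp R : R[i]^o -> R[i]^o).
Proof.
move=> z; have zr := cvg_Re (FF := nbhs_filter z) (@cvg_id _ (nbhs z)).
have zi := cvg_Im (FF := nbhs_filter z) (@cvg_id _ (nbhs z)).
have e := cvg_comp _ _ zr (@continuous_expR R (complex.Re z)).
have c := cvg_comp _ _ zi (@continuous_cos R (complex.Im z)).
have s := cvg_comp _ _ zi (@continuous_sin R (complex.Im z)).
apply: (cvg_complex (FF := nbhs_filter z)); rewrite /cexp.
  under eq_fun do rewrite Re_mul /= mul0r subr0.
  by rewrite Re_mul /= mul0r subr0; apply: (@cvgM _ _ _ (nbhs_filter z) _ _ _ _ e c).
under eq_fun do rewrite Im_mul /= mul0r addr0.
by rewrite Im_mul /= mul0r addr0; apply: (@cvgM _ _ _ (nbhs_filter z) _ _ _ _ e s).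
Qed.

(** Differentiation of a complex-valued function of a real variable is taken componentwise, so that
    the real rules and the real mean value theorem apply to each component. *)
Definition is_cderive (f : R -> R[i]) t (l : R[i]) :=
  is_derive t 1 (fun s => complex.Re (f s)) (complex.Re l) /\
  is_derive t 1 (fun s => complex.Im (f s)) (complex.Im l).

Lemma is_cderiveM f g t (df dg : R[i]) : is_cderive f t df -> is_cderive g t dg ->
  is_cderive (fun s => f s * g s) t (df * g t + f t * dg).
Proof.
move=> [f1 f2] [g1 g2]; split.
  under eq_fun do rewrite Re_mul.
  rewrite Re_add !Re_mul.
  apply: is_derive_eq; rewrite /GRing.scale /=; ring.
under eq_fun do rewrite Im_mul.
rewrite Im_add !Im_mul.
apply: is_derive_eq; rewrite /GRing.scale /=; ring.
Qed.

Lemma is_cderiveD f g t (df dg : R[i]) : is_cderive f t df -> is_cderive g t dg ->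
  is_cderive (fun s => f s + g s) t (df + dg).
Proof.
move=> [f1 f2] [g1 g2]; split.
  by under eq_fun do rewrite Re_add; rewrite Re_add; apply: is_derive_eq.
by under eq_fun do rewrite Im_add; rewrite Im_add; apply: is_derive_eq.
Qed.

Lemma is_cderive_cst z t : is_cderive (fun=> z) t 0.
Proof. by split; exact: is_derive_cst. Qed.

Lemma is_cderive_line z t : is_cderive (fun s => s%:C * z) t z.
Proof.
case: z => x y; split.
  under eq_fun do rewrite Re_mul /= mul0r subr0.
  by apply: is_derive_eq; rewrite /GRing.scale /=; ring.
under eq_fun do rewrite Im_mul /= mul0r addr0.
by apply: is_derive_eq; rewrite /GRing.scale /=; ring.
Qed.

Lemma is_derive_mulr x t : is_derive t 1 (fun s : R => s * x) x.
Proof. by apply: is_derive_eq; rewrite /GRing.scale /=; ring. Qed.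

Lemma is_cderive_cexp z t :
  is_cderive (fun s => cexp (s%:C * z)) t (z * cexp (t%:C * z)).
Proof.
case: z => x y; rewrite /cexp.
have e := @is_derive1_comp R _ (fun s => s * x) t _ _
  (is_derive_expR (t * x)) (is_derive_mulr x t).
have c := @is_derive1_comp R _ (fun s => s * y) t _ _
  (is_derive_cos (t * y)) (is_derive_mulr y t).
have s := @is_derive1_comp R _ (fun s => s * y) t _ _
  (is_derive_sin (t * y)) (is_derive_mulr y t).
split.
  under eq_fun do rewrite !(Re_mul, Im_mul) /= !(mul0r, subr0, addr0).
  rewrite !(Re_mul, Im_mul) /= !(mul0r, subr0, addr0).
  by apply: (is_derive_eq (is_deriveM e c)); rewrite /GRing.scale /=; ring.
under eq_fun do rewrite !(Re_mul, Im_mul) /= !(mul0r, subr0, addr0).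
rewrite !(Re_mul, Im_mul) /= !(mul0r, subr0, addr0).
by apply: (is_derive_eq (is_deriveM e s)); rewrite /GRing.scale /=; ring.
Qed.

Definition cexp_coeff z n : R[i] := (n`!%:R)^-1 * z ^+ n.

Lemma is_cderive_pow z n t :
  is_cderive (fun s => (s%:C * z) ^+ n.+1) t ((n.+1%:R * z) * (t%:C * z) ^+ n).
Proof.
elim: n => [|n IH].
  by rewrite expr0 mulr1 mul1r; exact: is_cderive_line.
have := is_cderiveM (is_cderive_line z t) IH.
rewrite (_ : _ + _ = n.+2%:R * z * (t%:C * z) ^+ n.+1).
  by under eq_fun do rewrite -exprS.
by rewrite -[n.+2]addn1 natrD exprS; ring.
Qed.

Lemma is_cderive_coeff z n t :
  is_cderive (fun s => cexp_coeff (s%:C * z) n.+1) t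
    (z * cexp_coeff (t%:C * z) n).
Proof.
rewrite /cexp_coeff.
have := is_cderiveM (is_cderive_cst (n.+1`!%:R)^-1 t) (is_cderive_pow z n t).
rewrite mul0r add0r factS natrM; congr is_cderive.
have n0 : (n.+1%:R : R[i]) != 0 by rewrite pnatr_eq0.
have f0 : (n`!%:R : R[i]) != 0 by rewrite pnatr_eq0 -lt0n fact_gt0.
by field; rewrite f0 -(natrD _ 1) n0.
Qed.

(** The constant term dies and each later term differentiates to [z] times its predecessor, which is
    why one term fewer appears on the right. *)
Lemma is_cderive_series z n t :
  is_cderive (fun s => series (cexp_coeff (s%:C * z)) n.+1) t
    (z * series (cexp_coeff (t%:C * z)) n).
Proof.
elim: n => [|n IH].
  rewrite /series /= big_geq // mulr0.
  under eq_fun do rewrite big_nat1 /cexp_coeff expr0 mulr1.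
  exact: is_cderive_cst.
have := is_cderiveD IH (is_cderive_coeff z n t).
rewrite -mulrDr; congr is_cderive; last by rewrite [in RHS]seriesSr.
by apply/funext => s; rewrite [in RHS]seriesSr.
Qed.

(** Interpolates along the segment from 0 to [z]: the value at [t = 0] is 1, and at [t = 1] it is
    the partial sum divided by [cexp z]. The series thus converges to [cexp z] once the value at 1
    tends to 1. *)
Definition cexp_remainder z n t : R[i] :=
  cexp (t%:C * - z) * series (cexp_coeff (t%:C * z)) n.+1.

(* The derivative telescopes: only the last term of the series survives. *)
Lemma is_cderive_remainder z n t :
  is_cderive (cexp_remainder z n) t
    (- z * cexp (t%:C * - z) * cexp_coeff (t%:C * z) n).
Proof.
have := is_cderiveM (is_cderive_cexp (- z) t) (is_cderive_series z n t).
congr is_cderive; rewrite [in LHS]seriesSr; ring.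
Qed.

Lemma normc_real x : Normc.normc x%:C = `|x|.
Proof. by rewrite /= expr0n addr0 sqrtr_sqr. Qed.

Lemma normcX z n : Normc.normc (z ^+ n) = Normc.normc z ^+ n.
Proof.
elim: n => [|n IH]; first by rewrite !expr0 Normc.normc1.
by rewrite !exprS Normc.normcM IH.
Qed.

Lemma normc_opp z : Normc.normc (- z) = Normc.normc z.
Proof. by case: z => x y /=; rewrite !sqrrN. Qed.

Lemma normc_ge0 z : 0 <= Normc.normc z.
Proof. by case: z => x y; exact: sqrtr_ge0. Qed.

(** On the unit interval the real part of [- t z] is at most [|z|], and [|t z| ^ n] is at most
    [|z| ^ n]. The resulting bound is free of [t], and it tends to 0 because the terms of the real
    exponential series do. *)
Lemma normc_remainder_le z n t : 0 <= t <= 1 ->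
  Normc.normc (- z * cexp (t%:C * - z) * cexp_coeff (t%:C * z) n) <=
  Normc.normc z * expR (Normc.normc z) * exp_coeff (Normc.normc z) n.
Proof.
move=> /andP[t0 t1]; rewrite 2!Normc.normcM normc_opp normc_cexp.
rewrite [X in _ * X]Normc.normcM normcX Normc.normcM Normc.normcV.
rewrite -(rmorph_nat (real_complex R) n`!) !normc_real.
rewrite (ger0_norm t0) ger0_norm ?ler0n //.
have z0 := normc_ge0 z.
apply: ler_pM; rewrite ?mulr_ge0 ?expR_ge0 ?invr_ge0 ?exprn_ge0 ?mulr_ge0 //.
  apply: ler_wpM2l => //; rewrite ler_expR.
  have := normr_Re_le z; rewrite ler_norml => /andP[h1 h2].
  by rewrite Re_mul /= mul0r subr0; case: (z) h1 z0 => a b /= h1 z0; nra.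
rewrite exp_coeffE mulrC /= mulrC ler_wpM2l ?invr_ge0 //.
by rewrite lerXn2r ?nnegrE ?mulr_ge0 // ler_piMl.
Qed.

Lemma is_cderive_continuous f (df : R -> R[i]) :
  (forall t, is_cderive f t (df t)) ->
  continuous (fun t => complex.Re (f t)) /\ continuous (fun t => complex.Im (f t)).
Proof.
move=> h; split=> t; apply: differentiable_continuous; apply/derivable1_diffP;
  by have [[]] := h t.
Qed.

(** By the mean value theorem on [[0, 1]], each component moves away from its value at 0 by at most
    the uniform bound [M n] on the derivative. *)
Lemma remainder_cvg z :
  ((cexp_remainder z n 1 : R[i]^o) @[n --> \oo] --> (1 : R[i]^o)).
Proof.
set M : nat -> R := fun n =>
  Normc.normc z * expR (Normc.normc z) * exp_coeff (Normc.normc z) n.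
have M0 : M @ \oo --> (0 : R).
  rewrite -[X in _ --> X](mulr0 (Normc.normc z * expR (Normc.normc z))).
  by apply: cvgMl_tmp; exact: cvg_exp_coeff.
(* Only the term of index 0 survives, through [0 ^+ 0 = 1]. *)
have r0 n : cexp_remainder z n 0 = 1.
  rewrite /cexp_remainder mul0r cexp0 mul1r /series /= big_nat_recl //=.
  rewrite /cexp_coeff expr0 mulr1 invr1 big1 ?addr0 // => i _.
  by rewrite mul0r expr0n mulr0.
have [cr ci] : (forall n, {within `[0, 1], continuous
     (fun t => complex.Re (cexp_remainder z n t))}) /\
   (forall n, {within `[0, 1], continuous
     (fun t => complex.Im (cexp_remainder z n t))}).
  split=> n; apply: continuous_subspaceT;
  by have [] := is_cderive_continuous (is_cderive_remainder z n).
have hr n : `|complex.Re (cexp_remainder z n 1) - 1| <= M n.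
  have [c] := MVT ltr01 (fun t _ => (is_cderive_remainder z n t).1) (cr n).
  rewrite in_itv /= => /andP[c0 c1]; rewrite r0 /= subr0 mulr1 => ->.
  apply: le_trans (normr_Re_le _) (normc_remainder_le _ _ _).
  by rewrite !ltW.
have hi n : `|complex.Im (cexp_remainder z n 1) - 0| <= M n.
  have [c] := MVT ltr01 (fun t _ => (is_cderive_remainder z n t).2) (ci n).
  rewrite in_itv /= => /andP[c0 c1]; rewrite r0 /= (subr0 1) mulr1 => ->.
  apply: le_trans (normr_Im_le _) (normc_remainder_le _ _ _).
  by rewrite !ltW.
apply: cvg_complex; apply/cvgrPdist_le => /= e e0; near=> n; rewrite distrC.
  apply: le_trans (hr n) _; near: n.
  move/cvgrPdist_le: M0 => /(_ _ e0); apply: filterS => n /=.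
  by rewrite sub0r normrN; apply: le_trans; exact: ler_norm.
apply: le_trans (hi n) _; near: n.
move/cvgrPdist_le: M0 => /(_ _ e0); apply: filterS => n /=.
by rewrite sub0r normrN; apply: le_trans; exact: ler_norm.
Unshelve. all: by end_near. Qed.

Lemma cvg_series_cexp z :
  (series (cexp_coeff z) : nat -> R[i]^o) @ \oo --> (cexp z : R[i]^o).
Proof.
(* The remainder of index [n] holds the first [n.+1] terms, hence the shift. *)
rewrite -cvg_shiftS.
under eq_fun => n.
  rewrite (_ : series _ _ = cexp z * cexp_remainder z n 1); last first.
    by rewrite /cexp_remainder !mul1r mulrA cexpN mul1r.
  over.
have h : (cexp z * cexp_remainder z n 1 : R[i]^o) @[n --> \oo] -->
  (cexp z * 1 : R[i]^o) := cvgM (cvg_cst _) (@remainder_cvg z).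
by rewrite mulr1 in h; apply: h.
Qed.

End ComplexExponential.

(** * Coordinatewise calculus in the algebra generated by an involution *)

Section Involution.
Variables (R : realType) (u : quat R[i]).
Hypothesis uu : u * u = 1.
Implicit Types x y : R[i].

(* [x * (1 + u) / 2 + y * (1 - u) / 2] *)
Definition idem_comb x y : quat R[i] := ((x + y) / 2)%:A + ((x - y) / 2) *: u.

Lemma idem_combD x y x' y' :
  idem_comb x y + idem_comb x' y' = idem_comb (x + x') (y + y').
Proof.
rewrite /idem_comb addrACA -[_%:A + _%:A]scalerDl -[_ *: u + _]scalerDl.
by congr (_ *: _ + _ *: _); field.
Qed.

Lemma idem_combZ c x y : c *: idem_comb x y = idem_comb (c * x) (c * y).
Proof.
rewrite /idem_comb scalerDr !scalerA; by congr (_ *: _ + _ *: _); field.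
Qed.

Lemma idem_combN x y : - idem_comb x y = idem_comb (- x) (- y).
Proof. by rewrite -scaleN1r idem_combZ !mulN1r. Qed.

Lemma idem_combM x y x' y' :
  idem_comb x y * idem_comb x' y' = idem_comb (x * x') (y * y').
Proof.
rewrite /idem_comb mulrDl !mulrDr -!scalerAl -!scalerAr uu !mul1r mulr1.
rewrite !scalerA [X in _ + X]addrC addrACA -[_%:A + _%:A]scalerDl.
rewrite -[_ *: u + _]scalerDl.
by congr (_ *: _ + _ *: _); field.
Qed.

Lemma idem_comb_diag x : idem_comb x x = x%:A.
Proof.
rewrite /idem_comb subrr mul0r scale0r addr0; congr (_ *: _).
by field.
Qed.

Lemma idem_combX x y n : idem_comb x y ^+ n = idem_comb (x ^+ n) (y ^+ n).
Proof.
elim: n => [|n IH]; first by rewrite !expr0 idem_comb_diag scale1r.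
by rewrite !exprS IH idem_combM.
Qed.

Lemma idem_comb_inv x y : x != 0 -> y != 0 ->
  (idem_comb x y)^-1 = idem_comb x^-1 y^-1.
Proof.
(* The ring [quat] is not commutative, so the element is first shown to be a unit, with a two-sided
   inverse, and then cancelled on the left. *)
move=> x0 y0; apply: (@mulrI _ (idem_comb x y)).
  apply/unitrP; exists (idem_comb x^-1 y^-1).
  by rewrite !idem_combM !mulVf ?mulfV // idem_comb_diag scale1r.
rewrite mulrV ?idem_combM ?mulfV // ?idem_comb_diag ?scale1r //.
apply/unitrP; exists (idem_comb x^-1 y^-1).
by rewrite !idem_combM !mulVf ?mulfV // idem_comb_diag scale1r.
Qed.

Lemma cvg_idem_comb {T : Type} {F : set_system T} {FF : Filter F}
    (f g : T -> R[i]^o) (x y : R[i]^o) :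
  f @ F --> x -> g @ F --> y -> idem_comb (f t) (g t) @[t --> F] --> idem_comb x y.
Proof.
move=> fx gy.
have p : ((f t + g t) / 2 : R[i]^o) @[t --> F] --> ((x + y) / 2 : R[i]^o).
  exact: cvgM (cvgD fx gy) (cvg_cst _).
have m : ((f t - g t) / 2 : R[i]^o) @[t --> F] --> ((x - y) / 2 : R[i]^o).
  exact: cvgM (cvgB fx gy) (cvg_cst _).
exact: cvgD (cvgZr_tmp (a := 1 : quat R[i]) p) (cvgZr_tmp (a := u) m).
Qed.

(** Powers, scalings and sums act on the two coordinates separately, so the partial sums of the
    quaternionic series pair those of two complex series. *)
Lemma qexp_idem_comb x y : qexp (idem_comb x y) = idem_comb (cexp x) (cexp y).
Proof.
rewrite /qexp (_ : series _ = fun n =>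
    idem_comb (series (cexp_coeff x) n) (series (cexp_coeff y) n)).
  apply: (cvg_lim (@norm_hausdorff _ _)).
  by apply: cvg_idem_comb; exact: cvg_series_cexp.
apply/funext; elim=> [|n IH].
  by rewrite /series /= !big_geq // idem_comb_diag scale0r.
rewrite !seriesSr IH idem_combX idem_combZ idem_combD.
by [].
Qed.

End Involution.

(** * The involution attached to a vector, and the power in its coordinates *)

Section Axis.
Variables (R : realType) (v : quat R).
Hypothesis hv : qscal v = 0.

Lemma qnormsq_ge0 : 0 <= qnormsq v.
Proof. by rewrite /qnormsq !addr_ge0 ?sqr_ge0. Qed.

Lemma qabs_eq0 : qabs v = 0 -> v = 0.
Proof.
move/eqP; rewrite /qabs sqrtr_eq0 => le0.
have /eqP : qnormsq v == 0 by rewrite eq_le le0 qnormsq_ge0.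
rewrite /qnormsq => e.
by apply: quatP; rewrite [RHS]mxE; nra.
Qed.

(** With zero scalar part the cross terms of the product cancel in pairs, leaving minus the sum of
    the squares. *)
Lemma quatC_sqr : quatC v * quatC v = (- (qabs v)%:C ^+ 2)%:A.
Proof.
rewrite -rmorphXn /= /qabs sqr_sqrtr ?qnormsq_ge0 // /qnormsq hv -rmorphN.
have c0 : qscal (quatC v) = 0 by rewrite /qscal mxE -/(qscal v) hv.
have c1 : q1 (quatC v) = (q1 v)%:C by rewrite /q1 mxE.
have c2 : q2 (quatC v) = (q2 v)%:C by rewrite /q2 mxE.
have c3 : q3 (quatC v) = (q3 v)%:C by rewrite /q3 mxE.
apply: quatP; rewrite qone_def qmul_def /qmul !qcoordE c0 c1 c2 c3;
  rewrite ?(rmorphN, rmorphD, rmorphXn) /=; ring.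
Qed.

Lemma mul_ii : 'i%C * 'i%C = -1 :> R[i].
Proof. by rewrite -sqr_i. Qed.

(* The junk value at [v = 0] only has to square to 1: then [quatC_qaxis] holds
   for every [v]. *)
Definition qaxis : quat R[i] :=
  if v == 0 then 1 else (- 'i%C / (qabs v)%:C) *: quatC v.

Lemma qabsC_neq0 : v != 0 -> (qabs v)%:C != 0.
Proof.
by apply: contraNneq; rewrite -[0]/(0%:C) => /complexI /qabs_eq0 /eqP.
Qed.

Lemma qaxis_sqr : qaxis * qaxis = 1.
Proof.
rewrite /qaxis; case: eqVneq => [_|v0]; first exact: mul1r.
rewrite -scalerAl -scalerAr quatC_sqr !scalerA -[RHS]scale1r; congr (_ *: _).
have n0 := qabsC_neq0 v0.
transitivity (- ('i%C * 'i%C) : R[i]); last by rewrite mul_ii opprK.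
by field.
Qed.

Lemma quatC_qaxis : quatC v = ('i%C * (qabs v)%:C) *: qaxis.
Proof.
rewrite /qaxis; case: eqVneq => [->|v0].
  rewrite (_ : qabs 0 = 0) ?mulr0 ?scale0r.
    by apply/rowP => k; rewrite !mxE.
  by rewrite /qabs /qnormsq /qscal /q1 /q2 /q3 !mxE expr0n !addr0 sqrtr0.
have n0 := qabsC_neq0 v0.
rewrite scalerA -[LHS]scale1r; congr (_ *: _).
transitivity (- ('i%C * 'i%C) : R[i]); first by rewrite mul_ii opprK.
by field.
Qed.

(** The two coordinates of [v] are [i |v|] and [- i |v|], as [v] is [i |v|] times an involution. *)
Lemma idem_comb_quatC (x y : R[i]) : x%:A + y *: quatC v =
  idem_comb qaxis (x + 'i%C * (qabs v)%:C * y) (x - 'i%C * (qabs v)%:C * y).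
Proof.
rewrite quatC_qaxis scalerA /idem_comb; by congr (_ *: _ + _ *: _); field.
Qed.

(** As [v / |v| = i u] with [u] the involution, the bracket in the power is [cos t + i u sin t]. By
    Euler's formula its coordinates are [exp (i t)] and [exp (- i t)], where [t = |v| log z]. *)
Lemma cqpow_idem_comb (z : R[i]) (a : R) : z != 0 ->
  cqpow z (a%:A + v) = idem_comb qaxis
    (cexp (a%:C * clog z + 'i%C * (qabs v)%:C * clog z))
    (cexp (a%:C * clog z - 'i%C * (qabs v)%:C * clog z)).
Proof.
move=> /negbTE z0; rewrite /cqpow z0.
have -> : qscal (a%:A + v) = a.
  by rewrite qone_def !qcoordE hv mulr1 addr0.
have -> : qvec (a%:A + v) = v.
  by apply: quatP; rewrite qone_def !qcoordE ?hv; ring.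
rewrite !cexpD -idem_combZ; congr (_ *: _).
set t := (qabs v)%:C * clog z.
rewrite (_ : 'i%C * _ * _ = 'i%C * t) ?mulrA // -mulrA -/t.
rewrite /idem_comb -/(ccos t); congr (_ + _).
have i0 : 'i%C != 0 :> R[i] by rewrite eq_complex /= oner_eq0 andbF.
(* For [v = 0] the sine term is dropped by definition. On the other side [t = 0] kills the
   coefficient of the axis, whatever its junk value. *)
case: eqVneq => [v0|v0].
  rewrite (_ : t = 0) ?mulr0 ?oppr0 ?subrr ?mul0r ?scale0r //.
  by rewrite /t v0 /qabs /qnormsq /qscal /q1 /q2 /q3 !mxE expr0n !addr0 sqrtr0 mul0r.
have n0 := qabsC_neq0 v0.
rewrite quatC_qaxis scalerA; congr (_ *: _); rewrite /csin.
by field; rewrite n0 i0.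
Qed.

End Axis.

(** * Taylor bounds for the cardinal sine, and the logarithm of the spline base *)

Section Sinc.
Variable R : realType.
Implicit Types h x t : R.

(** Serves to integrate inequalities from 0: starting from [cos_le1], each Taylor bound below is the
    previous one integrated once. *)
Lemma derive_ge0_ge (f df : R -> R) : (forall x, is_derive x 1 f (df x)) ->
  (forall x, 0 <= x -> 0 <= df x) -> forall x, 0 <= x -> f 0 <= f x.
Proof.
move=> fd df0 x x0.
have cf : {within `[0, x], continuous f}.
  apply: continuous_subspaceT => t.
  by apply: differentiable_continuous; apply/derivable1_diffP; have [] := fd t.
have [c] := MVT_segment x0 (fun t _ => fd t) cf.
rewrite in_itv /= => /andP[c0 _] e.
by rewrite -subr_ge0 e mulr_ge0 ?df0 ?subr0.
Qed.

Lemma sin_le_id x : 0 <= x -> sin x <= x.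
Proof.
move=> x0; rewrite -subr_ge0.
have fd t : is_derive t 1 (fun t => t - sin t)
    ((fun t => 1 - cos t) t).
  exact: is_deriveB.
have d0 t : 0 <= t -> 0 <= (fun t => 1 - cos t) t.
  by move=> t0; rewrite subr_ge0 cos_le1.
by have := derive_ge0_ge fd d0 x0; rewrite sin0 subr0.
Qed.

Lemma cos_ge_taylor2 x : 0 <= x -> 1 - x ^+ 2 / 2 <= cos x.
Proof.
move=> x0; rewrite -subr_ge0.
have fd t : is_derive t 1 (fun t => cos t - (1 - t ^+ 2 / 2))
    ((fun t => t - sin t) t).
  by apply: is_derive_eq; rewrite /GRing.scale /=; field.
have d0 t : 0 <= t -> 0 <= (fun t => t - sin t) t.
  by move=> t0; rewrite subr_ge0 sin_le_id.
by have := derive_ge0_ge fd d0 x0; rewrite cos0 expr0n mul0r subr0 subrr.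
Qed.

Lemma sin_ge_taylor3 x : 0 <= x -> x - x ^+ 3 / 6 <= sin x.
Proof.
move=> x0; rewrite -subr_ge0.
have fd t : is_derive t 1 (fun t => sin t - (t - t ^+ 3 / 6))
    ((fun t => cos t - (1 - t ^+ 2 / 2)) t).
  by apply: is_derive_eq; rewrite /GRing.scale /=; field.
have d0 t : 0 <= t -> 0 <= (fun t => cos t - (1 - t ^+ 2 / 2)) t.
  by move=> t0; rewrite subr_ge0 cos_ge_taylor2.
by have := derive_ge0_ge fd d0 x0; rewrite sin0 expr0n mul0r !subr0.
Qed.

Lemma cos_le_taylor4 x : 0 <= x -> cos x <= 1 - x ^+ 2 / 2 + x ^+ 4 / 24.
Proof.
move=> x0; rewrite -subr_ge0.
have fd t : is_derive t 1 (fun t => 1 - t ^+ 2 / 2 + t ^+ 4 / 24 - cos t)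
    ((fun t => sin t - (t - t ^+ 3 / 6)) t).
  by apply: is_derive_eq; rewrite /GRing.scale /=; field.
have d0 t : 0 <= t -> 0 <= (fun t => sin t - (t - t ^+ 3 / 6)) t.
  by move=> t0; rewrite subr_ge0 sin_ge_taylor3.
by have := derive_ge0_ge fd d0 x0; rewrite cos0 !expr0n !mul0r subr0 addr0 subrr.
Qed.

Lemma sin_le_taylor5 x : 0 <= x -> sin x <= x - x ^+ 3 / 6 + x ^+ 5 / 120.
Proof.
move=> x0; rewrite -subr_ge0.
have fd t : is_derive t 1 (fun t => t - t ^+ 3 / 6 + t ^+ 5 / 120 - sin t)
    ((fun t => 1 - t ^+ 2 / 2 + t ^+ 4 / 24 - cos t) t).
  by apply: is_derive_eq; rewrite /GRing.scale /=; field.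
have d0 t : 0 <= t -> 0 <= (fun t => 1 - t ^+ 2 / 2 + t ^+ 4 / 24 - cos t) t.
  by move=> t0; rewrite subr_ge0 cos_le_taylor4.
by have := derive_ge0_ge fd d0 x0; rewrite sin0 !expr0n !mul0r subr0 addr0 subrr.
Qed.

Definition sinc h : R := if h == 0 then 1 else sin h / h.

Lemma sincN h : sinc (- h) = sinc h.
Proof. by rewrite /sinc oppr_eq0 sinN invrN mulrNN. Qed.

(** The function is even, so [h >= 0] may be assumed. For [h > 0] these are the bounds of degree 3
    and 5 on the sine divided by [h], and at 0 the convention [sinc 0 = 1] fits both. *)
Lemma sinc_taylor h :
  1 - h ^+ 2 / 6 <= sinc h <= 1 - h ^+ 2 / 6 + h ^+ 4 / 120.
Proof.
wlog h0 : h / 0 <= h => [hw|].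
  have [/hw //|/ltW h0] := leP 0 h.
  have := hw (- h); rewrite sincN sqrrN (_ : (- h) ^+ 4 = h ^+ 4); last by ring.
  by rewrite oppr_ge0; apply.
rewrite /sinc; case: eqVneq => [->|hn0]; first by rewrite !expr0n /=; lra.
have hp : 0 < h by rewrite lt0r hn0.
rewrite ler_pdivlMr // ler_pdivrMr //.
have := sin_ge_taylor3 h0; have := sin_le_taylor5 h0.
rewrite !exprS expr0; lra.
Qed.

(** Both sides come from [ln (1 + x) <= x]: the upper one with [x = sinc h - 1], the lower one with
    [x = 1 / sinc h - 1]. The lower bound is [1 - 1 / (1 - h ^ 2 / 6)] in disguise, and [h ^ 2 < 6]
    keeps that denominator positive. *)
Lemma ln_sinc_bounds h : h ^+ 2 < 6 ->
  - (h ^+ 2 / 6) / (1 - h ^+ 2 / 6) <= ln (sinc h) <= - (h ^+ 2 / 6) + h ^+ 4 / 120.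
Proof.
move=> h6; have /andP[s1 s2] := sinc_taylor h.
have d0 : 0 < 1 - h ^+ 2 / 6 by lra.
have s0 : 0 < sinc h by exact: lt_le_trans s1.
apply/andP; split; last first.
  have := @le_ln1Dx R (sinc h - 1); rewrite [1 + _]addrC subrK => /(_ _) H.
  by apply: le_trans (H _) _; lra.
have := @le_ln1Dx R ((sinc h)^-1 - 1); rewrite [1 + _]addrC subrK lnV ?posrE // => H.
have i0 : 0 < (sinc h)^-1 by rewrite invr_gt0.
have {}H : - ln (sinc h) <= (sinc h)^-1 - 1 by apply: H; lra.
have : (sinc h)^-1 <= (1 - h ^+ 2 / 6)^-1 by rewrite lef_pV2 ?posrE.
have -> : - (h ^+ 2 / 6) / (1 - h ^+ 2 / 6) = 1 - (1 - h ^+ 2 / 6)^-1.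
  by field; rewrite gt_eqF //; lra.
lra.
Qed.

Definition spline_base (eta : R) : R[i] :=
  if eta == 0 then 1 else (1 - cexp (- ('i%C * eta%:C))) / ('i%C * eta%:C).

(** Polar form of the base, from [1 - exp (- 2 i h) = 2 i exp (- i h) sin h]. *)
Lemma spline_baseE h :
  spline_base (2 * h) = (sinc h)%:C * (cos h +i* (- sin h)).
Proof.
rewrite /spline_base /sinc mulf_eq0 pnatr_eq0 /=.
case: eqVneq => [->|h0]; first by rewrite cos0 sin0 oppr0 mul1r.
have n0 : 'i%C * (2 * h)%:C != 0 :> R[i].
  rewrite eq_complex /= !(mul0r, mulr0, mul1r, subr0, addr0, add0r).
  by rewrite mulf_eq0 pnatr_eq0 (negbTE h0) andbF.
apply: (mulIf n0); rewrite mulfVK //.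
rewrite /cexp /=; simpc; rewrite expR0 /= cosN sinN mulr_natl mulr2n cosD sinD.
rewrite !mul1r; apply/eqP; rewrite eq_complex /=; apply/andP; split; apply/eqP.
  by rewrite -[1](cos2Dsin2 h); field.
by field.
Qed.

(** For [|h| <= 1] the factor [sinc h] is positive, hence the modulus, and [- h] lies strictly
    between [- pi] and [pi], hence is the principal argument. *)
Lemma clog_spline_base h : `|h| <= 1 ->
  spline_base (2 * h) != 0 /\
  clog (spline_base (2 * h)) = ln (sinc h) +i* (- h).
Proof.
move=> h1; have /andP[s1 _] := sinc_taylor h.
have h2 : h ^+ 2 <= 1 by rewrite -real_normK ?num_real // expr_le1.
have s0 : 0 < sinc h by lra.
have pi1 : 1 < pi :> R by have := @pi_ge2 R; lra.
have ca : cabs (spline_base (2 * h)) = sinc h.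
  rewrite spline_baseE /cabs Re_mul Im_mul /= !(mul0r, subr0, addr0) !exprMn -mulrDr.
  by rewrite sqrrN cos2Dsin2 mulr1 sqrtr_sqr gtr0_norm.
split.
  apply: contra_eq_neq ca => ->; rewrite /cabs /= expr0n addr0 sqrtr0.
  by rewrite lt_eqF.
rewrite /clog /carg ca spline_baseE Re_mul Im_mul /= !(mul0r, subr0, addr0).
rewrite mulrAC mulfV ?gt_eqF // mul1r pmulr_rge0 // oppr_ge0.
congr (_ +i* _).
move: h1; rewrite ler_norml => /andP[hm hp].
(* The imaginary part has the sign of [- sin h]. For [h <= 0] the first branch of [carg] gives
   [acos (cos h) = - h]; for [h > 0] the second gives [- acos (cos h) = - h]. *)
have [h0|h0] := leP h 0.
  rewrite ifT ?cosKN //; first by rewrite h0 andbT; lra.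
  by rewrite -oppr_ge0 -sinN sin_ge0_pi // oppr_ge0 h0; lra.
rewrite ifF; last by apply/negbTE; rewrite -ltNge sin_gt0_pi // h0; lra.
by rewrite cosK // in_itv /= ltW //=; lra.
Qed.

End Sinc.

(** * The quotient in coordinates, and the limit of its logarithms *)

Section Quotient.
Variables (R : realType) (v : quat R) (xi : R).
Hypothesis hv : qscal v = 0.

Definition half_freq (a : R) := xi / (2 * Num.sqrt a).

Definition log_sinc (a : R) := ln (sinc (half_freq a)).

(* With [sigma = |v|] or [- |v|]: the logarithm of one of the two coordinates
   of the quotient with respect to the idempotents [(1 +- qaxis v) / 2]. *)
Definition log_quotient (sigma a : R) : R[i] :=
  (a * log_sinc a + sigma * half_freq a + qabs v / a +
     (xi / Num.sqrt 24 - sigma / Num.sqrt a) ^+ 2)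
  +i* (sigma * log_sinc a + sigma * (xi ^+ 2 / (24 * a))).

Lemma log_quotientE (sigma a : R) : 0 < a ->
  a%:C * (log_sinc a +i* (- half_freq a)) +
    'i%C * sigma%:C * (log_sinc a +i* (- half_freq a)) -
  (- ('i%C * (Num.sqrt a * xi / 2)%:C) - (qabs v / a)%:C -
    ((xi / Num.sqrt 24)%:C + 'i%C * sigma%:C * ('i%C / (Num.sqrt a)%:C)) ^+ 2 -
    'i%C * sigma%:C * (xi ^+ 2 / (24 * a))%:C) = log_quotient sigma a.
Proof.
move=> a0; rewrite /log_quotient -fmorphV expr2.
have sn0 : Num.sqrt a != 0 by rewrite lt0r_neq0 // sqrtr_gt0.
have as2 : a = Num.sqrt a ^+ 2 by rewrite sqr_sqrtr // ltW.
(* This identity makes the modulation cancel the phase [- a h] of the power. The other quantities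
   are then generalized, so that [ring] only meets this relation. *)
have ah : a * half_freq a = Num.sqrt a * xi / 2.
  by rewrite /half_freq {1}as2; field.
move: ah; move: (log_sinc a) (half_freq a) (xi / Num.sqrt 24) (xi ^+ 2 / _).
move=> l h x y ah; apply/eqP; rewrite eq_complex /=.
apply/andP; split; apply/eqP; last by rewrite -ah; ring.
by ring.
Qed.

(** Every factor has exponentials as its two coordinates, so products and inverses reduce to adding
    and negating exponents. The condition on [xi] says [|h| <= 1] for [h = half_freq a], as the
    principal logarithm requires. *)
Lemma spline_quotientE (a : R) : 0 < a -> xi ^+ 2 <= 4 * a ->
  Bhat (a%:A + v) (xi / Num.sqrt a) /
    (qexp (- ('i%C * (Num.sqrt a * xi / 2)%:C)%:A) *
     qexp (- ((qabs v / a)%:C)%:A) *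
     qexp (- (((xi / Num.sqrt 24)%:C)%:A
              + ('i%C / (Num.sqrt a)%:C) *: quatC v) ^+ 2) *
     qexp (- ((xi ^+ 2 / (24 * a))%:C *: quatC v))) =
  idem_comb (qaxis v) (cexp (log_quotient (qabs v) a))
                      (cexp (log_quotient (- qabs v) a)).
Proof.
move=> a0 xia.
have s0 : 0 < Num.sqrt a by rewrite sqrtr_gt0.
have sn0 := lt0r_neq0 s0.
have as2 : a = Num.sqrt a ^+ 2 by rewrite sqr_sqrtr // ltW.
have h1 : `|half_freq a| <= 1.
  rewrite -(@expr_le1 _ 2) // real_normK ?num_real // /half_freq expr_div_n.
  by rewrite ler_pdivrMr ?exprn_gt0 ?mulr_gt0 // exprMn -as2 mul1r -natrX.
have -> : xi / Num.sqrt a = 2 * half_freq a.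
  by rewrite /half_freq; field.
have [b0 lb] := clog_spline_base h1.
rewrite /Bhat -/(spline_base _) cqpow_idem_comb // lb -/(log_sinc a).
have uu := qaxis_sqr hv.
set n := (qabs v)%:C.
have e1 (c : R[i]) : qexp (- c%:A) = idem_comb (qaxis v) (cexp (- c)) (cexp (- c)).
  by rewrite -scaleNr -(idem_comb_diag (qaxis v)) (qexp_idem_comb uu).
have e3 (x y : R[i]) : qexp (- (x%:A + y *: quatC v) ^+ 2) =
    idem_comb (qaxis v) (cexp (- (x + 'i%C * n * y) ^+ 2))
                        (cexp (- (x - 'i%C * n * y) ^+ 2)).
  rewrite idem_comb_quatC (idem_combX uu) (idem_combN (qaxis v)).
  exact: qexp_idem_comb uu _ _.
have e4 (y : R[i]) : qexp (- (y *: quatC v)) =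
    idem_comb (qaxis v) (cexp (- ('i%C * n * y))) (cexp ('i%C * n * y)).
  have -> : - (y *: quatC v) = 0%:A + (- y) *: quatC v.
    by rewrite scale0r add0r scaleNr.
  rewrite idem_comb_quatC (qexp_idem_comb uu).
  have -> : 0 + 'i%C * n * - y = - ('i%C * n * y) by ring.
  by have -> : 0 - 'i%C * n * - y = 'i%C * n * y by ring.
have mE p q (x y x' y' : R[i]) : p = idem_comb (qaxis v) (cexp x) (cexp y) ->
    q = idem_comb (qaxis v) (cexp x') (cexp y') ->
    p * q = idem_comb (qaxis v) (cexp (x + x')) (cexp (y + y')).
  by move=> -> ->; rewrite (idem_combM uu) !cexpD.
have vE p (x y : R[i]) : p = idem_comb (qaxis v) (cexp x) (cexp y) ->
    p^-1 = idem_comb (qaxis v) (cexp (- x)) (cexp (- y)).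
  move=> ->; rewrite (idem_comb_inv uu (cexp_neq0 x) (cexp_neq0 y)).
  rewrite (cexpV x). rewrite (cexpV y). reflexivity.
set x0 := log_sinc a +i* _.
apply: (etrans (mE _ _ _ _ _ _ erefl
  (vE _ _ _ (mE _ _ _ _ _ _ (mE _ _ _ _ _ _ (mE _ _ _ _ _ _
    (e1 _) (e1 _)) (e3 _ _)) (e4 _))))).
have l1 := log_quotientE (qabs v) a0.
have l2 := log_quotientE (- qabs v) a0.
rewrite -l1 -l2 rmorphN -/n -/x0.
(* The first exponents agree already; in the second the sign of [- qabs v] remains to be moved out
   of the products. *)
apply: (f_equal (fun y => idem_comb _ _ (cexp y))).
by ring.
Qed.

Lemma cvg_inv_pinfty : (a^-1 : R) @[a --> +oo] --> (0 : R).
Proof. by apply/gtr0_cvgV0; [exact: nbhs_pinfty_gt | exact: cvg_id]. Qed.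

Lemma cvg_sqrt_pinfty : (Num.sqrt a : R) @[a --> +oo] --> +oo.
Proof.
apply/cvgryPge => A; near=> a.
have A0 : A <= `|A| by exact: ler_norm.
(* It is enough that [a >= A ^+ 2], since the square root of [A ^+ 2] is [|A|]. *)
apply: le_trans A0 _; rewrite -sqrtr_sqr; apply: ler_wsqrtr.
by near: a; apply: nbhs_pinfty_ge; exact: num_real.
Unshelve. all: by end_near. Qed.

Lemma cvg_inv_sqrt_pinfty : ((Num.sqrt a)^-1 : R) @[a --> +oo] --> (0 : R).
Proof.
apply/gtr0_cvgV0; last exact: cvg_sqrt_pinfty.
by near=> a; rewrite sqrtr_gt0; near: a; exact: nbhs_pinfty_gt.
Unshelve. all: by end_near. Qed.

Lemma cvg_half_freq : half_freq a @[a --> +oo] --> (0 : R).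
Proof.
rewrite /half_freq.
under eq_fun do rewrite invfM mulrA.
have h : (xi / 2 * (Num.sqrt a)^-1) @[a --> +oo] --> (xi / 2 * 0 : R).
  exact: cvgM (cvg_cst _) cvg_inv_sqrt_pinfty.
by rewrite mulr0 in h.
Qed.

Lemma half_freq_sqr (a : R) : 0 < a -> a * half_freq a ^+ 2 = xi ^+ 2 / 4.
Proof.
move=> a0; have as2 : a = Num.sqrt a ^+ 2 by rewrite sqr_sqrtr // ltW.
have sn0 : Num.sqrt a != 0 by rewrite lt0r_neq0 // sqrtr_gt0.
by rewrite /half_freq {1}as2; field.
Qed.

(** Squeeze: [a h ^ 2 = xi ^ 2 / 4] is constant, so multiplying [ln_sinc_bounds] by [a] leaves a
    fixed leading term and corrections that vanish with [h]. *)
Lemma cvg_mul_log_sinc : a * log_sinc a @[a --> +oo] --> (- (xi ^+ 2 / 24) : R).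
Proof.
have h2 : half_freq a ^+ 2 @[a --> +oo] --> (0 : R).
  under eq_fun do rewrite expr2; rewrite -[in nbhs _](mulr0 0).
  exact: cvgM cvg_half_freq cvg_half_freq.
(* The constants are [24 = 4 * 6] and [480 = 4 * 120], from [a h ^ 2 / 6] and [a h ^ 4 / 120]. *)
pose lo a := - (xi ^+ 2 / 24) / (1 - half_freq a ^+ 2 / 6).
pose hi a := - (xi ^+ 2 / 24) + xi ^+ 2 / 480 * half_freq a ^+ 2.
apply: (@squeeze_cvgr _ _ _ _ lo hi).
- near=> a.
  have a0 : 0 < a by near: a; exact: nbhs_pinfty_gt.
  have s : half_freq a ^+ 2 < 6.
    near: a; move/cvgrPdist_lt: h2 => /(_ 6 ltac:(lra)); apply: filterS => a.
    by rewrite sub0r normrN ger0_norm // sqr_ge0.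
  have /andP[l u] := ln_sinc_bounds s.
  have d0 : 1 - half_freq a ^+ 2 / 6 != 0 by rewrite gt_eqF //; lra.
  have hs := half_freq_sqr a0.
  apply/andP; split.
    have -> : lo a = a * (- (half_freq a ^+ 2 / 6) / (1 - half_freq a ^+ 2 / 6)).
      rewrite /lo mulrA; congr (_ / _); rewrite mulrN mulrA hs; by field.
    by apply: (ler_wpM2l (ltW a0)).
  have -> : hi a = a * (- (half_freq a ^+ 2 / 6) + half_freq a ^+ 4 / 120).
    have xe : xi ^+ 2 = 4 * (a * half_freq a ^+ 2) by rewrite hs; field.
    by rewrite /hi xe; field.
  by apply: (ler_wpM2l (ltW a0)).
- have l1 : 1 - half_freq a ^+ 2 / 6 @[a --> +oo] --> (1 - 0 / 6 : R).
    exact: cvgB (cvg_cst _) (cvgM h2 (cvg_cst _)).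
  rewrite mul0r subr0 in l1.
  have l2 : lo a @[a --> +oo] --> (- (xi ^+ 2 / 24) / 1 : R).
    exact: cvgM (cvg_cst _) (cvgV (oner_neq0 _) l1).
  by rewrite divr1 in l2.
- have l1 : hi a @[a --> +oo] --> (- (xi ^+ 2 / 24) + xi ^+ 2 / 480 * 0 : R).
    exact: cvgD (cvg_cst _) (cvgM (cvg_cst _) h2).
  by rewrite mulr0 addr0 in l1.
Unshelve. all: by end_near. Qed.

Lemma cvg_log_sinc : log_sinc a @[a --> +oo] --> (0 : R).
Proof.
have h : (a^-1 * (a * log_sinc a)) @[a --> +oo] --> (0 * - (xi ^+ 2 / 24) : R).
  exact: cvgM cvg_inv_pinfty cvg_mul_log_sinc.
rewrite mul0r in h; move: h; apply: cvg_trans; apply: near_eq_cvg.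
near=> a; have a0 : 0 < a by near: a; exact: nbhs_pinfty_gt.
by rewrite mulKf // gt_eqF.
Unshelve. all: by end_near. Qed.

(** In the real part the limit [- xi ^ 2 / 24] of [a * log_sinc a] cancels the square of
    [xi / sqrt 24], and the rest vanishes. Both terms of the imaginary part tend to 0. *)
Lemma cvg_log_quotient (sigma : R) :
  (log_quotient sigma a : R[i]^o) @[a --> +oo] --> (0 : R[i]^o).
Proof.
have s := cvg_inv_sqrt_pinfty.
apply: cvg_complex => /=.
  set x := xi / Num.sqrt 24.
  have x24 : x ^+ 2 = xi ^+ 2 / 24 by rewrite expr_div_n sqr_sqrtr // ler0n.
  have d : x - sigma / Num.sqrt a @[a --> +oo] --> (x - sigma * 0 : R).
    exact: cvgB (cvg_cst _) (cvgM (cvg_cst _) s).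
  rewrite mulr0 subr0 in d.
  under eq_fun do rewrite -/x expr2.
  have l : a * log_sinc a + sigma * half_freq a + qabs v / a +
      (x - sigma / Num.sqrt a) * (x - sigma / Num.sqrt a) @[a --> +oo] -->
      (- (xi ^+ 2 / 24) + sigma * 0 + qabs v * 0 + x * x : R).
    exact: cvgD (cvgD (cvgD cvg_mul_log_sinc (cvgM (cvg_cst _) cvg_half_freq))
      (cvgM (cvg_cst _) cvg_inv_pinfty)) (cvgM d d).
  by rewrite !mulr0 !addr0 -expr2 x24 addNr in l.
have y : xi ^+ 2 / (24 * a) @[a --> +oo] --> (xi ^+ 2 / 24 * 0 : R).
  under eq_fun do rewrite invfM mulrA.
  exact: cvgM (cvg_cst _) cvg_inv_pinfty.
have l : sigma * log_sinc a + sigma * (xi ^+ 2 / (24 * a)) @[a --> +oo] -->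
    (sigma * 0 + sigma * (xi ^+ 2 / 24 * 0) : R).
  exact: cvgD (cvgM (cvg_cst _) cvg_log_sinc) (cvgM (cvg_cst _) y).
by rewrite !mulr0 addr0 in l.
Qed.

End Quotient.

Theorem theorem5 (R : realType) (v : quat R) (hv : qscal v = 0) (xi : R) :
  Bhat (a%:A + v) (xi / Num.sqrt a) /
    (qexp (- ('i%C * (Num.sqrt a * xi / 2)%:C)%:A) *
     qexp (- ((qabs v / a)%:C)%:A) *
     qexp (- (((xi / Num.sqrt 24)%:C)%:A
              + ('i%C / (Num.sqrt a)%:C) *: quatC v) ^+ 2) *
     qexp (- ((xi ^+ 2 / (24 * a))%:C *: quatC v)))
    @[a --> +oo] --> (1 : quat R[i]).
Proof.
(* Continuity of [cexp] at 0 turns the limit 0 of the logarithms into the limit 1 of both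
   coordinates, and equal coordinates 1 stand for the unit quaternion. *)
have lim (sigma : R) : (cexp (log_quotient v xi sigma a) : R[i]^o) @[a --> +oo]
    --> (1 : R[i]^o).
  rewrite -(cexp0 R).
  exact: (cvg_comp _ _ (@cvg_log_quotient R v xi sigma) (@continuous_cexp R _)).
have h : idem_comb (qaxis v) (cexp (log_quotient v xi (qabs v) a))
    (cexp (log_quotient v xi (- qabs v) a)) @[a --> +oo] --> (1 : quat R[i]).
  have := cvg_idem_comb (u := qaxis v) (lim (qabs v)) (lim (- qabs v)).
  by rewrite idem_comb_diag scale1r; apply.
(* The coordinate form is available for [a > 0] with [xi ^ 2 <= 4 a], that is for all large [a],
   which suffices for the limit. *)
apply: cvg_trans h; apply: near_eq_cvg; near=> a.
have a0 : 0 < a by near: a; exact: nbhs_pinfty_gt.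
have xia : xi ^+ 2 <= 4 * a.
  suff : xi ^+ 2 / 4 <= a by lra.
  by near: a; apply: nbhs_pinfty_ge; exact: num_real.
by rewrite (spline_quotientE hv a0 xia).
Unshelve. all: by end_near. Qed.
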